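(* Let $F(y,h)=\theta(-h)-\gamma(y)\,\widehat{\jmath}''(y,h)$, with $\gamma$ and $\widehat{\jmath}$ as in the context, and regard $F$ as a function of $(\tau,h)$ through $y=\frac1m-\tau$. Suppose that $F(\tau=0,h)\in[0,1]$ pointwise in $h$, and that $F$ satisfies $$\partial_\tau F=\frac{|\dot\gamma(y)|}{2y}\,F''+|\dot\gamma(y)|\left(\widehat{\jmath}'-\frac{h\,\theta(-h)}{\gamma(y)}\right)F'+\frac{|\dot\gamma(y)|}{\gamma(y)}\,F(1-F),$$ with smooth coefficients on each open half-line ($h<0$ and $h>0$) and with $\widehat{\jmath}'$ bounded. Then $F(\tau,h)\in[0,1]$ for all $\tau\ge 0$ and all $h\in\mathbb{R}$.
   Context: Primes denote partial derivatives with respect to $h\in\mathbb{R}$ and dots derivatives with respect to $y$; $\theta(-h)$ is the Heaviside step, equal to $1$ for $h<0$ and $0$ for $h>0$. The variable $y$ runs from $y=1/m$ (where the initial condition is given, $m>0$ small) down to $y=1$, and $\tau=\frac1m-y$ increases from $0$ along this flow, so ''all $\tau\ge0$'' refers to the values of $\tau$ along the flow. The function $\gamma(y)>0$ is the full replica-symmetry-breaking (fullRSB) profile of hard spheres in infinite dimension near jamming; it has $\dot\gamma<0$ (with $\gamma(y)\sim\gamma_\infty y^{-c}$, $c\in(0,1)$, for large $y$), so the diffusion coefficient $|\dot\gamma|/(2y)$ and the reaction coefficient $|\dot\gamma|/\gamma$ are positive. The function $\widehat{\jmath}(y,h)$ is the fullRSB field, which obeys $$\partial_y\widehat{\jmath}=\frac{\dot\gamma(y)}{2y}\left[-\frac{\theta(-h)}{\gamma(y)}+\widehat{\jmath}''-2y\,\frac{h\,\theta(-h)}{\gamma(y)}\,\widehat{\jmath}'+y\,(\widehat{\jmath}')^2\right].$$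 In the application, the initial condition is $\widehat{\jmath}(1/m,h)\to0$ in the limit $m\to0$, which gives $F(\tau=0,h)=\theta(-h)\in\{0,1\}$. *)

(* Defs.v *)
(* Library: MathComp-Analysis. *)
From HB Require Import structures.
From mathcomp Require Import all_boot all_order all_algebra.
From mathcomp Require Import all_classical all_reals all_analysis.
Set Implicit Arguments.
Unset Strict Implicit.
Unset Printing Implicit Defensive.
Import Order.TTheory GRing.Theory Num.Theory.
Import numFieldNormedType.Exports.
Local Open Scope classical_set_scope.
Local Open Scope ring_scope.

(* The value at 0 is a convention: [heaviside (- h)] is only used in
   identities stated for h != 0, or multiplied by h. *)
Definition heaviside (R : realType) (x : R) : R := if 0 < x then 1 else 0.

Definition pd1 (R : realType) (f : R -> R -> R) : R -> R -> R :=
  fun s h => derive1 (fun u => f u h) s.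

Definition pd2 (R : realType) (f : R -> R -> R) : R -> R -> R :=
  fun s h => derive1 (f s) h.

Definition has_pd1 (R : realType) (f : R -> R -> R) (s h : R) : Prop :=
  derivable (fun u => f u h) s 1.

Definition has_pd2 (R : realType) (f : R -> R -> R) (s h : R) : Prop :=
  derivable (f s) h 1.

(* C^n and C^oo, jointly in the two variables; meaningful for [D] open. *)
Fixpoint Cn_on (R : realType) (n : nat) (D : set (R * R)) (f : R -> R -> R)
    : Prop :=
  match n with
  | 0%N => {in D, continuous (fun p : R * R => f p.1 p.2)}
  | n'.+1 =>
      (forall s h, D (s, h) -> has_pd1 f s h /\ has_pd2 f s h) /\
      Cn_on n' D (pd1 f) /\ Cn_on n' D (pd2 f)
  end.

Definition smooth_on (R : realType) (D : set (R * R)) (f : R -> R -> R) : Prop :=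
  forall n, Cn_on n D f.

Definition left_half (R : realType) (m : R) : set (R * R) :=
  [set p | 1 < p.1 < m^-1 /\ p.2 < 0].

Definition right_half (R : realType) (m : R) : set (R * R) :=
  [set p | 1 < p.1 < m^-1 /\ 0 < p.2].

Definition closed_strip (R : realType) (m : R) : set (R * R) :=
  [set p | 1 <= p.1 <= m^-1].

Definition fullRSB_profile (R : realType) (gamma : R -> R) : Prop :=
  [/\ forall y, 1 <= y -> 0 < gamma y,
      {within [set y | 1 <= y], continuous gamma},
      forall y, 1 < y -> derivable gamma y 1 /\ derive1 gamma y < 0
    & exists ginf c : R, [/\ 0 < ginf, 0 < c < 1 &
        gamma y / (ginf * y `^ (- c)) @[y --> +oo] --> (1 : R)] ].

(* [j] is a classical solution: [j'] is continuous on the closed strip, so in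
   particular across h = 0 and up to the initial line y = 1/m, whereas [j'']
   exists only for h != 0, since it jumps with theta(-h) at h = 0. *)
Definition fullRSB_field (R : realType) (gamma : R -> R) (m : R)
    (j : R -> R -> R) : Prop :=
  [/\ forall y h, 1 <= y <= m^-1 -> has_pd2 j y h,
      {within closed_strip m, continuous (fun p : R * R => pd2 j p.1 p.2)},
      forall y h, 1 <= y <= m^-1 -> h != 0 -> has_pd2 (pd2 j) y h
    & forall y h, 1 < y < m^-1 -> h != 0 ->
        has_pd1 j y h /\
        pd1 j y h = derive1 gamma y / (2 * y) *
          (- (heaviside (- h) / gamma y) + pd2 (pd2 j) y h
           - 2 * y * (h * heaviside (- h) / gamma y) * pd2 j y h
           + y * pd2 j y h ^+ 2) ].

(* The defining formula of [F] has no meaning at h = 0, where theta(-h) and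
   [j''] have compensating jumps; past the initial line the value of [F]
   there is the one that makes it continuous.  At y = 1/m, where [F] may be
   discontinuous (e.g. theta(-h) if [j] vanishes), it is left free. *)
Definition is_F (R : realType) (gamma : R -> R) (m : R) (j F : R -> R -> R)
    : Prop :=
  (forall y h, 1 <= y <= m^-1 -> h != 0 ->
     F y h = heaviside (- h) - gamma y * pd2 (pd2 j) y h) /\
  (forall y, 1 <= y < m^-1 -> {for 0, continuous (F y)}).

Definition in_tau (R : realType) (m : R) (F : R -> R -> R) : R -> R -> R :=
  fun tau h => F (m^-1 - tau) h.

Definition diffusion (R : realType) (gamma : R -> R) (y : R) : R :=
  `|derive1 gamma y| / (2 * y).

Definition drift (R : realType) (gamma : R -> R) (j : R -> R -> R) (y h : R)
    : R :=
  `|derive1 gamma y| * (pd2 j y h - h * heaviside (- h) / gamma y).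

Definition reaction (R : realType) (gamma : R -> R) (y : R) : R :=
  `|derive1 gamma y| / gamma y.

Definition smooth_coefficients (R : realType) (gamma : R -> R)
    (j : R -> R -> R) (D : set (R * R)) : Prop :=
  [/\ smooth_on D (fun y _ => diffusion gamma y),
      smooth_on D (drift gamma j)
    & smooth_on D (fun y _ => reaction gamma y)].

Definition solves_F_equation (R : realType) (gamma : R -> R) (m : R)
    (j F : R -> R -> R) : Prop :=
  let Ft := in_tau m F in
  forall tau h, 0 < tau < m^-1 - 1 -> h != 0 ->
    let y := m^-1 - tau in
    [/\ has_pd1 Ft tau h, has_pd2 Ft tau h, has_pd2 (pd2 Ft) tau h
      & pd1 Ft tau h = diffusion gamma y * pd2 (pd2 Ft) tau h
                       + drift gamma j y h * pd2 Ft tau h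
                       + reaction gamma y * (Ft tau h * (1 - Ft tau h))].

(* Main.v *)
(* The bounds F >= 0 and F <= 1 say that j - min(h,0)^2 / (2 gamma) and
   - j - max(h,0)^2 / (2 gamma) are concave in h.  The first function J solves
   J_y = gamma' / (2 y) (J'' + y J'^2), the second one a similar equation with an
   extra term linear in h J', and both are C^1 in h across h = 0.  Such equations,
   run from y = 1/m down to y = 1, preserve concavity: at a positive maximum of
   J(x) + J(z) - 2 J((x + z)/2) the first derivatives at the three points agree,
   so the first-order terms cancel, while the second-order terms have the right
   sign.  This argument only uses the equation of j away from h = 0, because
   adding eps |h| to a function which is C^1 across h = 0 moves its maximum away
   from h = 0; the jump of j'' there is therefore harmless. *)
Require Import Defs.
From HB Require Import structures.
From mathcomp Require Import all_boot all_order all_algebra.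
From mathcomp Require Import all_classical all_reals all_analysis.
From mathcomp Require Import ring lra.
Set Implicit Arguments.
Unset Strict Implicit.
Unset Printing Implicit Defensive.
Import Order.TTheory GRing.Theory Num.Theory.
Import numFieldNormedType.Exports.
Local Open Scope classical_set_scope.
Local Open Scope ring_scope.

(** * One-variable calculus: first- and second-order tests *)

Lemma is_derive_approx (R : realType) (f : R -> R) (x a e : R) :
  is_derive x 1 f a -> 0 < e ->
  exists2 d, 0 < d & forall t, `|t| < d -> `|f (x + t) - f x - a * t| <= e * `|t|.
Proof.
move=> /is_derive1_caratheodory[g [fg cg ga]] e0.
have /cvgrPdist_lt/(_ _ e0)/nbhs_ballP[d /= d0 dg] := cg.
exists d => // t td.
have : `|g x - g (x + t)| < e.
  by apply: dg; rewrite /ball /= opprD addrA subrr add0r normrN.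
rewrite fg addrAC subrr add0r -mulrBl normrM -ga distrC => /ltW gt.
by rewrite ler_wpM2r.
Qed.

(** An upper bound on increments suffices because [s] takes both signs: stepping in the direction
    given by the sign of [l] makes the increment close to [|l| * |s|]. *)
Lemma is_derive_le_lipschitz (R : realType) (f : R -> R) (a l L : R) :
  is_derive a 1 f l -> (forall s, f (a + s) - f a <= L * `|s|) -> `|l| <= L.
Proof.
move=> fl fL; rewrite leNgt; apply/negP => lL.
have e0 : 0 < (`|l| - L) / 2 by lra.
have [d d0 fd] := is_derive_approx fl e0.
pose t := if 0 <= l then d / 2 else - (d / 2).
have tE : `|t| = d / 2 by rewrite /t; case: ifP; rewrite ?normrN ger0_norm//; lra.
have lt : l * t = `|l| * (d / 2).
  rewrite /t; have [l0|l0] := lerP 0 l; first by rewrite ger0_norm.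
  by rewrite ltr0_norm// mulrN mulNr.
have := fd t; rewrite tE lt => /(_ _)/ler_normlP[|+ _]; first by lra.
by have := fL t; rewrite tE; nra.
Qed.

(** The symmetric second difference of a differentiable function is o(|s|), which excludes the
    linear decrease produced by a kink. *)
Lemma is_derive_no_concave_kink (R : realType) (f : R -> R) (a l c : R) :
  is_derive a 1 f l -> 0 < c ->
  ~ (forall s, f (a + s) + f (a - s) - 2 * f a <= - (c * `|s|)).
Proof.
move=> fl c0 fc.
have e0 : 0 < c / 4 by lra.
have [d d0 fd] := is_derive_approx fl e0.
have d2 : `|d / 2| = d / 2 by rewrite ger0_norm; lra.
have := fd (d / 2); have := fd (- (d / 2)); have := fc (d / 2).
rewrite normrN d2 => h /(_ _)/ler_normlP[|+ _]; first lra.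
by move=> h1 /(_ _)/ler_normlP[|+ _]; [lra|nra].
Qed.

(** The mean value theorem is applied to [f (a + s) + f (a - s)], whose derivative is about
    [2 * l * s]; this needs [f'] near [a] but its derivative only at [a]. *)
Lemma is_derive2_le0 (R : realType) (f f' : R -> R) (a l : R) :
  (\forall x \near a, is_derive x (1 : R) f (f' x)) -> is_derive a 1 f' l ->
  (forall s, f (a + s) + f (a - s) - 2 * f a <= 0) -> l <= 0.
Proof.
move=> /nbhs_ballP[d1 /= d10 ff'] fl fa; rewrite leNgt; apply/negP => l0.
have e0 : 0 < l / 2 by lra.
have [d d0 fd] := is_derive_approx fl e0.
pose t := Num.min d d1 / 2.
have t0 : 0 < t by rewrite divr_gt0// lt_min d0.
have td : t < d by rewrite ltr_pdivrMr// gt_min; apply/orP; left; lra.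
have td1 : t < d1 by rewrite ltr_pdivrMr// gt_min; apply/orP; right; lra.
pose g s := f (a + s) + f (a - s).
have dg (s : R) : `|s| < d1 -> is_derive s 1 g (f' (a + s) - f' (a - s)).
  move=> sd1.
  have h1 : is_derive (a + s) 1 f (f' (a + s)).
    by apply: ff'; rewrite /ball /= opprD addrA subrr add0r normrN.
  have h2 : is_derive (a - s) 1 f (f' (a - s)).
    by apply: ff'; rewrite /ball /= opprB addrC subrK.
  by apply: is_derive_eq; ring.
have gc : {within `[0, t], continuous g}.
  apply: derivable_within_continuous => s; rewrite in_itv/= => /andP[s0 st].
  by apply: (@ex_derive _ _ _ _ _ _ _ (dg s _)); rewrite ger0_norm//; lra.
have dg' (s : R) : s \in `]0, t[ -> is_derive s (1 : R) g (f' (a + s) - f' (a - s)).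
  by rewrite in_itv/= => /andP[s0 st]; apply: dg; rewrite gtr0_norm//; lra.
have [s] := MVT t0 dg' gc.
rewrite in_itv/= => /andP[s0 st]; rewrite /g addr0 subr0.
have := fd s; have := fd (- s); have := fa t.
rewrite normrN gtr0_norm// => h /(_ _)/ler_normlP[|_ h1]; first lra.
move=> /(_ _)/ler_normlP[|h2 _]; first lra.
have ls : 0 < l * s by rewrite mulr_gt0.
have : 0 < (f' (a + s) - f' (a - s)) * t by rewrite mulr_gt0//; lra.
lra.
Qed.

(** One-sided on purpose: the maximum in [y] to which it is applied may sit at the left end of the
    interval. *)
Lemma is_derive_le0_right_max (R : realType) (f : R -> R) (a l d : R) :
  is_derive a 1 f l -> 0 < d -> (forall s, 0 <= s <= d -> f (a + s) <= f a) ->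
  l <= 0.
Proof.
move=> fl d0 fa; rewrite leNgt; apply/negP => l0.
have e0 : 0 < l / 2 by lra.
have [d1 d10 fd] := is_derive_approx fl e0.
pose t := Num.min d d1 / 2.
have t0 : 0 < t by rewrite divr_gt0// lt_min d0.
have td : t < d by rewrite ltr_pdivrMr// gt_min; apply/orP; left; lra.
have td1 : t < d1 by rewrite ltr_pdivrMr// gt_min; apply/orP; right; lra.
have lt : 0 < l * t by rewrite mulr_gt0.
have := fd t; rewrite gtr0_norm// => /(_ td1)/ler_normlP[h _].
have /fa : 0 <= t <= d by apply/andP; split; exact: ltW.
lra.
Qed.

(** * Lipschitz bounds and joint continuity of increments *)

Lemma is_derive_lipschitz (R : realType) (f df : R -> R) (a b K : R) :
  (forall x, is_derive x (1 : R) f (df x)) ->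
  (forall x, Num.min a b <= x <= Num.max a b -> `|df x| <= K) ->
  `|f b - f a| <= K * `|b - a|.
Proof.
move=> fdf; wlog ab : a b / a <= b.
  move=> wlg dfK; have [ab|ba] := leP a b; first exact: wlg.
  rewrite distrC (distrC b); apply: wlg; first exact: ltW.
  by rewrite minC maxC.
rewrite (min_idPl ab) (max_idPr ab) => dfK.
have fc : {within `[a, b], continuous f}.
  by apply: derivable_within_continuous => x _; exact: (@ex_derive _ _ _ _ _ _ _ (fdf x)).
have [x] := MVT_segment ab (fun x _ => fdf x) fc.
by rewrite in_itv/= => xab ->; rewrite normrM ler_wpM2r// dfK.
Qed.

(* The increments of [u] in [h] are as continuous as its [h]-derivative; [u]
   itself may be discontinuous in [y]. *)
Lemma continuous_increment (R : realType) (u v : R -> R -> R) :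
  (forall y h, is_derive h (1 : R) (u y) (v y h)) ->
  continuous (fun p : R * R => v p.1 p.2) ->
  continuous (fun p : R * R => u p.1 p.2 - u p.1 0).
Proof.
move=> uv vc [y0 h0]; apply/cvgrPdist_lt => /= e e0.
pose r := `|h0| + 1.
have r0 : 0 < r by rewrite ltr_wpDl.
have e10 : 0 < e / 2 / r by rewrite !divr_gt0.
(* Compactness of [[- r, r]] makes the closeness of [v y] to [v y0] uniform in [x]; the mean value
   bound on [u y0 - u y] then costs at most [e / 2], since [|h| < r]. *)
have tube : \forall y \near y0, `[- r, r] `<=` (fun x => `|v y0 x - v y x| < e / 2 / r).
  have /compact_near_coveringP/(_ _ (nbhs y0) (fun y x => `|v y0 x - v y x| < e / 2 / r)) :=
    @segment_compact R (- r) r.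
  apply => x _.
  have e20 : 0 < e / 2 / r / 2 by rewrite divr_gt0.
  have /cvgrPdist_lt/(_ _ e20) := vc (y0, x).
  case=> -[A B] [/= Ay Bx] AB.
  exists (B, A) => // -[x' y] [/= Bx' Ay'].
  have /= h1 := AB (y, x') (conj Ay' Bx').
  have /= h2 := AB (y0, x') (conj (nbhs_singleton Ay) Bx').
  rewrite distrC in h2; have := ler_distD (v y0 x) (v y0 x') (v y x'); lra.
have uc : \forall h \near h0, `|u y0 h0 - u y0 h| < e / 2.
  have /(@differentiable_continuous _ _ _ _ _)/cvgrPdist_lt : differentiable (u y0) h0.
    by apply/derivable1_diffP; exact: (@ex_derive _ _ _ _ _ _ _ (uv y0 h0)).
  by apply; rewrite divr_gt0.
have hr : \forall h \near h0, `|h| < r.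
  have /cvgrPdist_lt/(_ _ ltr01) := @cvg_id _ (nbhs h0).
  apply: filterS => h hh; rewrite /r -ltrBlDl.
  by apply: le_lt_trans hh; rewrite distrC lerB_dist.
exists ([set y | `[- r, r] `<=` (fun x => `|v y0 x - v y x| < e / 2 / r)],
  [set h | `|u y0 h0 - u y0 h| < e / 2 /\ `|h| < r]); first by split => //; apply: filterI.
move=> [y h] [/= yt [uh hr']].
have df x : is_derive x (1 : R) (fun x => u y0 x - u y x) (v y0 x - v y x).
  by have h1 := uv y0 x; have h2 := uv y x; apply: is_derive_eq.
have /ltr_normlP[hr1 hr2] := hr'.
have dfK x : Num.min 0 h <= x <= Num.max 0 h -> `|v y0 x - v y x| <= e / 2 / r.
  move=> xh; apply/ltW/yt; rewrite /= in_itv/=.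
  by move: xh; have [h0'|h0'] := leP 0 h => /andP[? ?]; apply/andP; split; lra.
have := is_derive_lipschitz df dfK; rewrite subr0 => hh.
have : e / 2 / r * `|h| <= e / 2 by rewrite -mulrA ger_pMr ?divr_gt0// ler_pdivrMl// mulr1 ltW.
have -> : u y0 h0 - u y0 0 - (u y h - u y 0) =
  (u y0 h0 - u y0 h) + (u y0 h - u y h - (u y0 0 - u y 0)) by ring.
by have := ler_normD (u y0 h0 - u y0 h) (u y0 h - u y h - (u y0 0 - u y 0)); lra.
Qed.

(** * Midpoint gaps and the conditions at a penalised maximum *)

Definition midpoint_gap (R : realType) (f : R -> R) (x z : R) : R :=
  f x + f z - 2 * f ((x + z) / 2).

(* The convex kinks [eps * |.|] keep the maxima of a differentiable function
   plus this penalty off the lines x = 0, z = 0 and x + z = 0, where the equation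
   is not available. *)
Definition penalty (R : realType) (eps D x z : R) : R :=
  eps * (`|x| + `|z| + `|(x + z) / 2|) - D * (1 + x ^+ 2 + z ^+ 2).

Lemma norm_second_difference (R : realType) (x s : R) :
  2 * `|x| <= `|x + s| + `|x - s|.
Proof.
have <- : `|2 * x| = 2 * `|x| by rewrite normrM ger0_norm.
have -> : 2 * x = (x + s) + (x - s) by ring.
exact: ler_normD.
Qed.

Lemma penalised_max_fst (R : realType) (f f' : R -> R) (eps D x z : R) :
  0 < eps -> (forall h, is_derive h (1 : R) f (f' h)) ->
  (forall s, midpoint_gap f (x + s) z + penalty eps D (x + s) z <=
             midpoint_gap f x z + penalty eps D x z) ->
  [/\ x != 0, (x + z) / 2 != 0 &
      `|f' x - f' ((x + z) / 2) - 2 * D * x| <= 3 / 2 * eps].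
Proof.
rewrite /midpoint_gap /penalty => eps0 ff' fmax.
(* [g] keeps the differentiable terms in the first variable. A step [s] moves the midpoint by
   [s / 2], so the two kinks involved have slopes [eps] and [eps / 2], whence the bound
   [3 / 2 * eps]. *)
pose g (s : R) := f s - 2 * f ((s + z) / 2) - D * s ^+ 2.
have dg : is_derive x (1 : R) g (f' x - f' ((x + z) / 2) - 2 * D * x).
  have h1 := ff' x; have h2 := ff' ((x + z) / 2).
  by apply: is_derive_eq; rewrite /GRing.scale/=; lra.
have gE s : g (x + s) - g x <= eps * (`|x| - `|x + s|) +
    eps * (`|(x + z) / 2| - `|(x + z) / 2 + s / 2|).
  have := fmax s; rewrite /g.
  have -> : (x + s + z) / 2 = (x + z) / 2 + s / 2 by ring.
  lra.
have k1 s := norm_second_difference x s.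
have k2 s := norm_second_difference ((x + z) / 2) (s / 2).
split.
- apply/eqP => x0; apply: (is_derive_no_concave_kink dg eps0) => s.
  have := gE s; have := gE (- s); have := k2 s.
  rewrite x0 !add0r normr0 normrN mulNr; have := normr_ge0 s; nra.
- apply/eqP => x0; apply: (is_derive_no_concave_kink dg eps0) => s.
  have := gE s; have := gE (- s); have := k1 s.
  have s2 : `|s / 2| = `|s| / 2 by rewrite normrM (@ger0_norm _ (2^-1)).
  rewrite x0 !add0r normr0 mulNr normrN s2; nra.
- apply: (is_derive_le_lipschitz dg) => s; apply: le_trans (gE s) _.
  have s2 : `|s / 2| = `|s| / 2 by rewrite normrM (@ger0_norm _ (2^-1)).
  have h1 : `|x| - `|x + s| <= `|s|.
    by rewrite lerBlDl -{1}(addrK s x) ler_normB.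
  have h2 : `|(x + z) / 2| - `|(x + z) / 2 + s / 2| <= `|s| / 2.
    by rewrite lerBlDl -s2 -{1}(addrK (s / 2) ((x + z) / 2)) ler_normB.
  nra.
Qed.

Lemma penalised_max (R : realType) (f f' f'' : R -> R) (eps D x z : R) :
  let m := (x + z) / 2 in
  0 < eps -> (forall h, is_derive h (1 : R) f (f' h)) ->
  (forall h, h != 0 -> is_derive h (1 : R) f' (f'' h)) ->
  (forall x' z', midpoint_gap f x' z' + penalty eps D x' z' <=
                 midpoint_gap f x z + penalty eps D x z) ->
  [/\ [/\ x != 0, z != 0 & m != 0],
      `|f' x - f' m - 2 * D * x| <= 3 / 2 * eps,
      `|f' z - f' m - 2 * D * z| <= 3 / 2 * eps &
      f'' x + f'' z - 2 * f'' m <= 4 * D].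
Proof.
move=> m eps0 ff' ff'' fmax.
have [x0 m0 dx] := penalised_max_fst eps0 ff' (fun s => fmax (x + s) z).
have symE x' z' : midpoint_gap f x' z' + penalty eps D x' z' =
    midpoint_gap f z' x' + penalty eps D z' x'.
  by rewrite /midpoint_gap /penalty (addrC z' x'); lra.
have [z0 _] : [/\ z != 0, (z + x) / 2 != 0 &
    `|f' z - f' ((z + x) / 2) - 2 * D * z| <= 3 / 2 * eps].
  apply: (penalised_max_fst eps0 ff') => s.
  by rewrite symE [leRHS]symE; exact: fmax.
rewrite (addrC z) => dz; split => //.
(* Translating both points by [s] translates the midpoint as well; the kinks have nonnegative second
   differences and drop out, while the quadratic part contributes [4 * D]. *)
pose g (s : R) := f (x + s) + f (z + s) - 2 * f (m + s) - 2 * D * s ^+ 2.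
pose g' (s : R) := f' (x + s) + f' (z + s) - 2 * f' (m + s) - 4 * D * s.
suff : f'' x + f'' z - 2 * f'' m - 4 * D <= 0 by lra.
apply: (@is_derive2_le0 _ g g' 0).
- near=> s; have h1 := ff' (x + s); have h2 := ff' (z + s).
  have h3 := ff' (m + s).
  by apply: is_derive_eq; rewrite /g' /GRing.scale/=; lra.
- have h1 : is_derive (x + 0) (1 : R) f' (f'' x) by rewrite addr0; exact: ff''.
  have h2 : is_derive (z + 0) (1 : R) f' (f'' z) by rewrite addr0; exact: ff''.
  have h3 : is_derive (m + 0) (1 : R) f' (f'' m) by rewrite addr0; exact: ff''.
  by apply: is_derive_eq; rewrite /GRing.scale/=; lra.
- move=> s; rewrite /g !add0r !addr0.
  have := fmax (x + s) (z + s); have := fmax (x - s) (z - s).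
  rewrite /midpoint_gap /penalty.
  have -> : (x + s + (z + s)) / 2 = m + s by rewrite /m; lra.
  have -> : (x - s + (z - s)) / 2 = m - s by rewrite /m; lra.
  rewrite -/m.
  have := norm_second_difference x s; have := norm_second_difference z s.
  have := norm_second_difference m s; nra.
Unshelve. all: by end_near.
Qed.

(** Here [p], [a], [b] stand for the slopes at the midpoint, at [x] and at [z]. Since [a - p] and
    [b - p] are of order [D] times a linear function of the position, every term of the equation is
    controlled by the size [D * (1 + x ^+ 2 + z ^+ 2)] of the penalty. *)
Lemma penalty_absorbs (R : realType) (B D x z p a b q al ka be : R) :
  0 < D <= 1 -> `|p| <= B * (1 + `|x| + `|z|) ->
  `|a - p - 2 * D * x| <= D -> `|b - p - 2 * D * z| <= D -> q <= 4 * D ->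
  0 <= al <= B -> `|ka| <= B -> `|be| <= B ->
  al * q + ka * (a ^+ 2 + b ^+ 2 - 2 * p ^+ 2) + be * (x * a + z * b - (x + z) * p)
    <= (12 * B ^+ 2 + 16 * B) * D * (1 + x ^+ 2 + z ^+ 2).
Proof.
move=> /andP[D0 D1] pB ax bz qD /andP[al0 alB] kaB beB.
have B0 : 0 <= B by apply: le_trans alB.
rewrite -(real_normK (num_real x)) -(real_normK (num_real z)).
have close (c w : R) : `|c - p - 2 * D * w| <= D -> `|c - p| <= D * (2 * `|w| + 1).
  move=> h; have := ler_normD (c - p - 2 * D * w) (2 * D * w).
  by rewrite subrK 2!normrM (@ger0_norm _ 2)// (@gtr0_norm _ D)//; lra.
have := close _ _ ax; have := close _ _ bz.
have xa : `|x * (a - p) + z * (b - p)| <= `|x| * `|a - p| + `|z| * `|b - p|.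
  by rewrite -!normrM; exact: ler_normD.
have quad : `|a ^+ 2 + b ^+ 2 - 2 * p ^+ 2| <=
    2 * `|p| * (`|a - p| + `|b - p|) + `|a - p| ^+ 2 + `|b - p| ^+ 2.
  have -> : a ^+ 2 + b ^+ 2 - 2 * p ^+ 2 =
    2 * p * (a - p) + 2 * p * (b - p) + ((a - p) ^+ 2 + (b - p) ^+ 2) by ring.
  apply: le_trans (ler_normD _ _) _.
  rewrite (@ger0_norm _ ((a - p) ^+ 2 + (b - p) ^+ 2)) ?addr_ge0 ?sqr_ge0//.
  rewrite !real_normK ?num_real// -addrA lerD2r.
  apply: le_trans (ler_normD _ _) _.
  by rewrite !normrM (@ger0_norm _ 2)//; lra.
move: pB xa quad; move: (normr_ge0 p) (normr_ge0 (a - p)) (normr_ge0 (b - p)).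
have h1 : be * (x * a + z * b - (x + z) * p) <= B * `|x * (a - p) + z * (b - p)|.
  have -> : x * a + z * b - (x + z) * p = x * (a - p) + z * (b - p) by ring.
  by apply: le_trans (ler_norm _) _; rewrite normrM ler_wpM2r.
have h2 : ka * (a ^+ 2 + b ^+ 2 - 2 * p ^+ 2) <= B * `|a ^+ 2 + b ^+ 2 - 2 * p ^+ 2|.
  by apply: le_trans (ler_norm _) _; rewrite normrM ler_wpM2r.
have h3 : al * q <= B * (4 * D).
  by apply: le_trans (ler_wpM2l al0 qD) _; rewrite ler_wpM2r; lra.
move: (normr_ge0 x) (normr_ge0 z) h1 h2.
move: `|x| `|z| `|p| `|a - p| `|b - p| `|x * (a - p) + z * (b - p)|
  `|a ^+ 2 + b ^+ 2 - 2 * p ^+ 2| => X Z P S T U Q X0 Z0 h1 h2 P0 S0 T0 pB xa quad TD SD.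
set N := 1 + X ^+ 2 + Z ^+ 2.
have XN : 2 * X + 2 * Z <= 2 * N by rewrite /N; have := sqr_ge0 (X - 1); have := sqr_ge0 (Z - 1); have := sqr_ge0 X; have := sqr_ge0 Z; nra.
have hU : U <= D * (4 * N).
  apply: le_trans xa _; apply: (@le_trans _ _ (X * (D * (2 * X + 1)) + Z * (D * (2 * Z + 1)))).
    by rewrite lerD// ler_wpM2l.
  have -> : X * (D * (2 * X + 1)) + Z * (D * (2 * Z + 1)) = D * (2 * X ^+ 2 + X + 2 * Z ^+ 2 + Z) by ring.
  by rewrite ler_wpM2l ?(ltW D0)//; rewrite /N in XN *; lra.
have hST : P * (S + T) <= B * D * (6 * N).
  apply: (@le_trans _ _ (B * (1 + X + Z) * (D * (2 * X + 1) + D * (2 * Z + 1)))).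
    by apply: ler_pM => //; lra.
  have -> : B * (1 + X + Z) * (D * (2 * X + 1) + D * (2 * Z + 1)) =
    B * D * (2 * (1 + X + Z) ^+ 2) by ring.
  rewrite ler_wpM2l ?mulr_ge0 ?(ltW D0)//.
  by rewrite /N; have := sqr_ge0 (X - 1); have := sqr_ge0 (Z - 1); have := sqr_ge0 (X - Z); nra.
have hS w s : 0 <= w -> 0 <= s -> s <= D * (2 * w + 1) -> s ^+ 2 <= D * (8 * w ^+ 2 + 2).
  move=> w0 s0 sD; apply: (@le_trans _ _ ((D * (2 * w + 1)) ^+ 2)).
    by rewrite ler_sqr ?nnegrE// mulr_ge0 ?(ltW D0)//; lra.
  (* One of the two factors [D] is given up, using [D <= 1]. *)
  rewrite exprMn; apply: (@le_trans _ _ (D * (2 * w + 1) ^+ 2)).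
    by rewrite ler_wpM2r ?sqr_ge0// expr2 ger_pMr.
  by rewrite ler_wpM2l ?(ltW D0)//; have := sqr_ge0 (2 * w - 1); nra.
have hQ : Q <= 12 * B * D * N + 8 * D * N.
  have := hS _ _ X0 S0 SD; have := hS _ _ Z0 T0 TD; rewrite /N in hST *; nra.
have hQB := ler_wpM2l B0 hQ; have hUB := ler_wpM2l B0 hU.
have N1 : 1 <= N by rewrite /N -addrA lerDl addr_ge0 ?sqr_ge0.
have : B * (4 * D) <= B * (4 * D) * N by rewrite ler_peMr// !mulr_ge0// ltW.
(* The quadratic term gives [12 * B ^+ 2 + 8 * B]; the linear and the diffusion terms give [4 * B]
   each. *)
have -> : (12 * B ^+ 2 + 16 * B) * D * N =
  B * (12 * B * D * N + 8 * D * N) + B * (D * (4 * N)) + B * (4 * D) * N by ring.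
lra.
Qed.

(** * Continuity and coercivity of the penalised gap *)

Lemma continuous_comp_into (T U V : topologicalType) (A : set U) (f : U -> V)
    (g : T -> U) :
  {within A, continuous f} -> continuous g -> (forall x, A (g x)) ->
  continuous (f \o g).
Proof.
move=> /subspace_continuousP fA gc gA x.
apply: (@cvg_comp _ _ _ g f _ _ _ _ (fA _ (gA x))) => P AP.
exact: (@filterS _ (nbhs x) _ _ _ (fun t h => h (gA t)) (gc x _ AP)).
Qed.

Lemma continuous_pair (T U V : topologicalType) (f : T -> U) (g : T -> V) x :
  {for x, continuous f} -> {for x, continuous g} ->
  {for x, continuous (fun t => (f t, g t))}.
Proof. by move=> fc gc; exact: (cvg_pair fc gc). Qed.

(** Adding a function of [y] alone to [u] leaves the gap unchanged, so the gap depends only on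
    increments in [h], and these are jointly continuous. Clamping [y] to [[a, b]] makes the function
    global. *)
Lemma continuous_midpoint_gap (R : realType) (a b : R) (u v : R -> R -> R) :
  a <= b ->
  (forall y h, a <= y <= b -> is_derive h (1 : R) (u y) (v y h)) ->
  {within [set p | a <= p.1 <= b], continuous (fun p : R * R => v p.1 p.2)} ->
  continuous (fun p : R * (R * R) =>
    midpoint_gap (u (Num.max a (Num.min b p.1))) p.2.1 p.2.2).
Proof.
move=> ab uv vc; pose clamp y := Num.max a (Num.min b y).
have clampab y : a <= clamp y <= b.
  by rewrite le_max lexx/= ge_max ab ge_min lexx.
have clampc : continuous clamp.
  move=> y; apply: (@continuous_max _ _ (cst a) (fun y => Num.min b y)); first exact: cvg_cst.
  by apply: (@continuous_min _ _ (cst b) id); [exact: cvg_cst|exact: cvg_id].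
have Vc : continuous (fun p : R * R => v (clamp p.1) p.2).
  apply: (continuous_comp_into (g := fun p : R * R => (clamp p.1, p.2)) vc) => [p|p].
    apply: (@continuous_pair _ _ _ (fun p : R * R => clamp p.1) snd).
      by apply: continuous_comp; [exact: cvg_fst|exact: clampc].
    exact: cvg_snd.
  exact: clampab.
have Gc := continuous_increment (fun y h => uv _ h (clampab y)) Vc.
set G := (fun p : R * R => u (clamp p.1) p.2 - u (clamp p.1) 0) in Gc.
have -> : (fun p : R * (R * R) => midpoint_gap (u (clamp p.1)) p.2.1 p.2.2) =
    (fun p => G (p.1, p.2.1) + G (p.1, p.2.2) - 2 * G (p.1, (p.2.1 + p.2.2) / 2)).
  by apply/funext => p; rewrite /midpoint_gap /G /=; ring.
move=> p.
have c1 : {for p, continuous (fun p : R * (R * R) => p.1)} by exact: cvg_fst.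
have c2 : {for p, continuous (fun p : R * (R * R) => p.2.1)}.
  by apply: continuous_comp; [exact: cvg_snd|exact: cvg_fst].
have c3 : {for p, continuous (fun p : R * (R * R) => p.2.2)}.
  by apply: continuous_comp; [exact: cvg_snd|exact: cvg_snd].
have Gf (f : R * (R * R) -> R) : {for p, continuous f} ->
    {for p, continuous (fun p => G (p.1, f p))}.
  move=> fc; apply: (continuous_comp (g := G)); last exact: Gc.
  exact: (@continuous_pair _ _ _ fst f).
apply: cvgB; first by apply: cvgD; apply: Gf.
apply: cvgM; first exact: cvg_cst.
by apply: Gf; apply: cvgM; [apply: cvgD|exact: cvg_cst].
Qed.

(** The kink slope is tied to [d <= D], so the quadratic part wins everywhere; hence the penalty
    creates no positive value on the line [y = b]. *)
Lemma penalty_le0 (R : realType) (d D x z : R) :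
  0 <= d <= D -> penalty (d / 2) D x z <= 0.
Proof.
move=> /andP[d0 dD]; rewrite /penalty subr_le0.
rewrite -(real_normK (num_real x)) -(real_normK (num_real z)).
have : `|(x + z) / 2| <= (`|x| + `|z|) / 2.
  by rewrite normrM (@ger0_norm _ (2^-1))// ler_wpM2r// ler_normD.
move: (normr_ge0 x) (normr_ge0 z) `|(x + z) / 2| => X0 Z0 M MXZ.
apply: (@le_trans _ _ (d * (1 + `|x| ^+ 2 + `|z| ^+ 2))); last first.
  by rewrite ler_wpM2r// !addr_ge0// sqr_ge0.
rewrite -mulrA ler_wpM2l//.
by have := sqr_ge0 (`|x| - 1 / 2); have := sqr_ge0 (`|z| - 1 / 2); lra.
Qed.

(** A gap of linear growth [C] is beaten by the quadratic part beyond an explicit radius, which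
    confines the positive values to a compact box. *)
Lemma penalty_coercive (R : realType) (C d D x z : R) :
  0 <= C -> 0 < d <= D -> 2 * (C + d) / d <= `|x| ->
  C * (`|x| + `|z|) + penalty (d / 2) D x z <= 0.
Proof.
move=> C0 /andP[d0 dD]; set k := (C + d) / d => kx.
have Ck : C = k * d - d by rewrite /k divfK ?gt_eqF//; lra.
have k0 : 0 <= k by rewrite /k divr_ge0//; lra.
have {}kx : 2 * k <= `|x| by rewrite /k mulrA.
rewrite /penalty -(real_normK (num_real x)) -(real_normK (num_real z)).
have : `|(x + z) / 2| <= (`|x| + `|z|) / 2.
  by rewrite normrM (@ger0_norm _ (2^-1))// ler_wpM2r// ler_normD.
move: (normr_ge0 x) (normr_ge0 z) `|(x + z) / 2| => X0 Z0 M MXZ.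
have : d * (1 + `|x| ^+ 2 + `|z| ^+ 2) <= D * (1 + `|x| ^+ 2 + `|z| ^+ 2).
  by rewrite ler_wpM2r// !addr_ge0// sqr_ge0.
have : d / 2 * (`|x| + `|z| + M) <= d * (`|x| + `|z|) by rewrite -mulrA ler_wpM2l//; lra.
have : d * (k * (`|x| + `|z|)) <= d * (`|x| ^+ 2 + `|z| ^+ 2).
  rewrite ler_wpM2l//; first exact: ltW.
  have := sqr_ge0 (`|z| - k / 2); have : 0 <= (`|x| - 2 * k) * (`|x| + k) by rewrite mulr_ge0//; lra.
  have := sqr_ge0 k; nra.
rewrite Ck; lra.
Qed.

Lemma continuous_penalty (R : realType) (eps : R) (D : R * (R * R) -> R) :
  continuous D ->
  continuous (fun p : R * (R * R) => penalty eps (D p) p.2.1 p.2.2).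
Proof.
move=> Dc p.
have c2 : {for p, continuous (fun p : R * (R * R) => p.2.1)}.
  by apply: continuous_comp; [exact: cvg_snd|exact: cvg_fst].
have c3 : {for p, continuous (fun p : R * (R * R) => p.2.2)}.
  by apply: continuous_comp; [exact: cvg_snd|exact: cvg_snd].
apply: cvgB.
  apply: cvgM; first exact: cvg_cst.
  apply: cvgD; first by apply: cvgD; apply: cvg_norm.
  by apply: cvg_norm; apply: cvgM; [exact: cvgD|exact: cvg_cst].
apply: cvgM; first exact: Dc.
apply: cvgD; last exact: cvgM.
by apply: cvgD; [exact: cvg_cst|exact: cvgM].
Qed.

(** * Maximum principle for the midpoint gap *)

(* Using [gamma] as the clock in the weight [expR (lam * gamma y)] puts the
   factor [derive1 gamma y] in front of every term of the [y]-derivative at the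
   maximum, so no bound on [derive1 gamma] is needed. *)
Lemma midpoint_gap_le0 (R : realType) (a b B C : R) (gamma : R -> R)
    (u ux uxx : R -> R -> R) (al ka be c : R -> R) :
  a < b -> 0 <= C ->
  {within `[a, b], continuous gamma} ->
  (forall y, a <= y <= b -> 0 <= gamma y) ->
  (forall y, a < y < b -> derivable gamma y 1 /\ derive1 gamma y < 0) ->
  (forall y, a < y < b -> [/\ 0 <= al y <= B, `|ka y| <= B & `|be y| <= B]) ->
  (forall y h, a <= y <= b -> is_derive h (1 : R) (u y) (ux y h)) ->
  {within [set p | a <= p.1 <= b], continuous (fun p : R * R => ux p.1 p.2)} ->
  (forall y h, a < y < b -> h != 0 -> is_derive h (1 : R) (ux y) (uxx y h)) ->
  (forall y h, a < y < b -> h != 0 -> is_derive y (1 : R) (u ^~ h)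
     (derive1 gamma y * (al y * uxx y h + ka y * ux y h ^+ 2
                         + be y * h * ux y h + c y))) ->
  (forall y h, a <= y <= b -> `|ux y h| <= B * (1 + `|h|)) ->
  (forall y x z, a <= y <= b -> midpoint_gap (u y) x z <= C * (`|x| + `|z|)) ->
  (forall x z, midpoint_gap (u b) x z <= 0) ->
  forall y x z, a <= y <= b -> midpoint_gap (u y) x z <= 0.
Proof.
move=> ab C0 gc g0 dg coefB du uxc dux pde uxB gapC gapb y1 x1 z1.
have gapc := continuous_midpoint_gap (ltW ab) du uxc.
(* The equation holds only for interior [y]. The case [y1 = b] is a hypothesis, and a positive gap
   at [a] would persist at nearby interior [y] by continuity. *)
wlog : y1 / a < y1 < b => [wlg y1ab|y1ab _].
  move: (y1ab) => /andP[]; rewrite le_eqVlt => /predU1P[<-{y1 y1ab} _|ay1]; last first.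
    by rewrite le_eqVlt => /predU1P[->|y1b]; [exact: gapb|apply: wlg; rewrite ?ay1].
  rewrite leNgt; apply/negP => gap0.
  have e0 : 0 < midpoint_gap (u a) x1 z1 by [].
  have := gapc (a, (x1, z1)); rewrite /continuous_at /=.
  have -> : Num.max a (Num.min b a) = a by rewrite (min_idPr (ltW ab)) maxxx.
  move=> /cvgrPdist_lt/(_ _ e0)[[P Q] /= [/nbhs_ballP[r /= r0 rP] Qn] PQ].
  pose y := a + Num.min r (b - a) / 2.
  have rba : 0 < Num.min r (b - a) by rewrite lt_min r0 subr_gt0.
  have rr : Num.min r (b - a) <= r by rewrite ge_min lexx.
  have rb : Num.min r (b - a) <= b - a by rewrite ge_min lexx orbT.
  have yab : a < y < b by rewrite /y; apply/andP; split; lra.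
  have Py : P y by apply: rP; rewrite /ball /= /y opprD addrA subrr add0r normrN gtr0_norm; lra.
  have /= := PQ (y, (x1, z1)) (conj Py (nbhs_singleton Qn)).
  have /andP[ay yb] := yab; rewrite (min_idPr (ltW yb)) (max_idPr (ltW ay)).
  have := wlg y yab; rewrite (ltW ay) (ltW yb) => /(_ isT) gy /ltr_normlP[_]; lra.
rewrite leNgt; apply/negP => gap0.
have [yG _ Gmax] := EVT_max (ltW ab) gc.
have {}Gmax y : a <= y <= b -> gamma y <= gamma yG.
  by move=> yab; apply: Gmax; rewrite in_itv.
(* The constant of [penalty_absorbs] plus one; the extra one makes the final inequality strict. *)
pose lam := 12 * B ^+ 2 + 16 * B + 1.
have lam1 : 1 <= lam.
  have /andP[al0 alB] : 0 <= al y1 <= B by have [] := coefB _ y1ab.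
  by rewrite /lam lerDr addr_ge0 ?mulr_ge0 ?sqr_ge0//; exact: le_trans alB.
pose E := expR (lam * gamma yG).
have E0 : 0 < E by exact: expR_gt0.
pose N1 := 1 + x1 ^+ 2 + z1 ^+ 2.
have N10 : 0 < N1 by rewrite /N1 -addrA ltr_pwDl// addr_ge0 ?sqr_ge0.
(* Division by [E], the largest weight, turns this into a bound on [D y] for all [y]: [D y <= 1],
   and the penalty takes at most half of the gap at [(y1, x1, z1)]. *)
pose d := Num.min 1 (midpoint_gap (u y1) x1 z1 / (2 * N1)) / E.
have d0 : 0 < d by rewrite divr_gt0// lt_min ltr01 divr_gt0// mulr_gt0.
pose D y := d * expR (lam * gamma y).
have expE y : a <= y <= b -> 1 <= expR (lam * gamma y) <= E.
  move=> yab; rewrite -expR0 !ler_expR mulr_ge0 ?g0//=; last lra.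
  by rewrite ler_wpM2l ?Gmax//; lra.
have Dd y : a <= y <= b -> 0 < d <= D y.
  by move=> /expE/andP[h1 h2]; rewrite d0 /D ler_peMr// ltW.
have DE y : a <= y <= b -> D y <= Num.min 1 (midpoint_gap (u y1) x1 z1 / (2 * N1)).
  move=> /expE/andP[h1 h2]; rewrite -[leRHS](divfK (lt0r_neq0 E0)) -/d /D.
  by rewrite ler_wpM2l// ltW.
pose Psi y x z := midpoint_gap (u y) x z + penalty (d / 2) (D y) x z.
have y1ab' : a <= y1 <= b by case/andP: y1ab => ? ?; rewrite !ltW.
have Psi1 : 0 < Psi y1 x1 z1.
  have := DE _ y1ab'; rewrite le_min => /andP[_]; rewrite ler_pdivlMr ?mulr_gt0//.
  rewrite /Psi /penalty -/N1 => h.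
  have : 0 <= d / 2 * (`|x1| + `|z1| + `|(x1 + z1) / 2|).
    by rewrite mulr_ge0 ?addr_ge0// divr_ge0// ltW.
  lra.
have Psib y x z : a <= y <= b -> 0 < Psi y x z ->
    (y != b) && (`|x| <= 2 * (C + d) / d) && (`|z| <= 2 * (C + d) / d).
  move=> yab; apply: contraTT; rewrite !negb_and negbK -!ltNge -leNgt => /orP[/orP[/eqP ->|h]|h].
  - have dDb : 0 <= d <= D b by have /andP[? ?] := Dd b (introT andP (conj (ltW ab) (lexx b))); rewrite ltW.
    by have := gapb x z; have := penalty_le0 x z dDb; rewrite /Psi; lra.
  - have := penalty_coercive z C0 (Dd _ yab) (ltW h); have := gapC _ x z yab.
    by rewrite /Psi; lra.
  - have := penalty_coercive x C0 (Dd _ yab) (ltW h); have := gapC _ x z yab.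
    by rewrite /Psi /penalty (addrC z x); lra.
pose r := 2 * (C + d) / d.
(* Outside this box, for [y] in [[y1, b]], the penalised gap is nonpositive, so its maximum over the
   box is a maximum over all [x] and [z]. *)
pose box := `[y1, b] `*` (`[- r, r] `*` `[- r, r]).
have inbox y x z : y1 <= y <= b -> 0 < Psi y x z -> box (y, (x, z)).
  move=> /andP[y1y yb] /Psib; rewrite yb andbT => /(_ _)/andP[|/andP[_ xr] zr].
    by case/andP: y1ab' => h _; apply: le_trans y1y.
  by split; rewrite /= ?in_itv/= ?y1y//; split; rewrite /= ?in_itv/= -ler_norml.
have boxc : compact box.
  by apply: compact_setX; [|apply: compact_setX]; exact: segment_compact.
pose clamp y := Num.max a (Num.min b y).
have clampE y : a <= y <= b -> clamp y = y.
  by case/andP => ay yb; rewrite /clamp (min_idPr yb) (max_idPr ay).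
have Dc : continuous (fun p : R * (R * R) => D (clamp p.1)).
  move=> p; apply: cvgM; first exact: cvg_cst.
  apply: continuous_comp; last exact: continuous_expR.
  apply: cvgM; first exact: cvg_cst.
  apply: (continuous_comp_into (g := fun p : R * (R * R) => clamp p.1) gc) => {}p.
    apply: (@continuous_max _ _ (cst a) (fun p => Num.min b p.1)); first exact: cvg_cst.
    by apply: (@continuous_min _ _ (cst b) fst); [exact: cvg_cst|exact: cvg_fst].
  by rewrite /= in_itv/= /clamp le_max lexx/= ge_max (ltW ab) ge_min lexx.
pose F (p : R * (R * R)) := midpoint_gap (u (clamp p.1)) p.2.1 p.2.2 +
  penalty (d / 2) (D (clamp p.1)) p.2.1 p.2.2.
have Fc : continuous F.
  by move=> p; apply: cvgD; [exact: gapc|exact: continuous_penalty].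
have box1 : box (y1, (x1, z1)).
  by apply: inbox => //; rewrite lexx ltW//; case/andP: y1ab.
have [[y0 [x0 z0]]] := compact_EVT_max (ex_intro _ _ box1) boxc (continuous_subspaceT Fc).
rewrite inE => -[/=]; rewrite in_itv/= => /andP[y10 y0b] _ Fmax.
have y1E y : y1 <= y <= b -> a <= y <= b.
  by case/andP: y1ab => /ltW ay _ /andP[yy ->]; rewrite andbT; exact: le_trans yy.
have FE y x z : y1 <= y <= b -> F (y, (x, z)) = Psi y x z.
  by move=> yb; rewrite /F /Psi /= clampE// y1E.
have y0y : y1 <= y0 <= b by rewrite y10.
have Psi0 : 0 < Psi y0 x0 z0.
  apply: lt_le_trans Psi1 _; rewrite -!FE ?y0y//; last by rewrite lexx; case/andP: y1ab => _ /ltW.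
  by apply: Fmax; rewrite inE.
have Psimax y x z : y1 <= y <= b -> Psi y x z <= Psi y0 x0 z0.
  move=> yb; have [h|h] := leP (Psi y x z) 0; first exact: le_trans (ltW Psi0).
  by rewrite -!FE//; apply: Fmax; rewrite inE; exact: inbox.
have y0ab : a < y0 < b.
  have /andP[/andP[yb _] _] := Psib _ _ _ (y1E _ y0y) Psi0.
  by case/andP: y1ab => h _; rewrite (lt_le_trans h y10)/= lt_neqAle yb.
have y0ab' := y1E _ y0y.
have D0 := Dd _ y0ab'.
have d20 : 0 < d / 2 by rewrite divr_gt0.
set m := (x0 + z0) / 2.
have [] := @penalised_max _ (u y0) (ux y0) (uxx y0) (d / 2) (D y0) x0 z0 d20
  (fun h => du _ h y0ab') (fun h => dux _ h y0ab) (fun x z => Psimax y0 x z y0y).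
rewrite -/m => -[x00 z00 m0] dx dz d2.
have D1 : D y0 <= 1 by have := DE _ y0ab'; rewrite le_min => /andP[].
have /andP[_ dD] := D0.
have [gd gN] := dg _ y0ab.
have [al0 ka0 be0] := coefB _ y0ab.
have absorb := @penalty_absorbs _ B (D y0) x0 z0 (ux y0 m) (ux y0 x0) (ux y0 z0)
  (uxx y0 x0 + uxx y0 z0 - 2 * uxx y0 m) (al y0) (ka y0) (be y0).
have {}absorb := absorb _ _ _ _ d2 al0 ka0 be0.
(* The source [c y] cancels in the gap because it does not depend on [h]. *)
have dPsi : is_derive y0 (1 : R) (fun y => Psi y x0 z0)
  (derive1 gamma y0 * (al y0 * (uxx y0 x0 + uxx y0 z0 - 2 * uxx y0 m) +
     ka y0 * (ux y0 x0 ^+ 2 + ux y0 z0 ^+ 2 - 2 * ux y0 m ^+ 2) +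
     be y0 * (x0 * ux y0 x0 + z0 * ux y0 z0 - (x0 + z0) * ux y0 m) -
     lam * D y0 * (1 + x0 ^+ 2 + z0 ^+ 2))).
  have h1 := pde _ _ y0ab x00; have h2 := pde _ _ y0ab z00; have h3 := pde _ _ y0ab m0.
  have hg : is_derive y0 (1 : R) gamma (derive1 gamma y0).
    by apply: DeriveDef => //; rewrite derive1E.
  have he : is_derive (lam * gamma y0) (1 : R) (@expR R) (expR (lam * gamma y0)).
    exact: is_derive_expR.
  rewrite /Psi /midpoint_gap /penalty /D -/m.
  by apply: is_derive_eq; rewrite /GRing.scale/=; move: (ux y0 m) => w; rewrite /m; field.
(* The maximum has [y0 < b], so the derivative to its right is nonpositive. As
   [derive1 gamma y0 < 0], the bracket is nonnegative, whereas absorption bounds it by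
   [- D y0 * (1 + x0 ^+ 2 + z0 ^+ 2) < 0]. *)
have : derive1 gamma y0 * (al y0 * (uxx y0 x0 + uxx y0 z0 - 2 * uxx y0 m) +
     ka y0 * (ux y0 x0 ^+ 2 + ux y0 z0 ^+ 2 - 2 * ux y0 m ^+ 2) +
     be y0 * (x0 * ux y0 x0 + z0 * ux y0 z0 - (x0 + z0) * ux y0 m) -
     lam * D y0 * (1 + x0 ^+ 2 + z0 ^+ 2)) <= 0.
  have y0b' : 0 < b - y0 by case/andP: y0ab => _; lra.
  apply: (is_derive_le0_right_max dPsi y0b') => s /andP[s0 sb].
  by apply: Psimax; apply/andP; split; lra.
rewrite nmulr_rle0// => h.
have N0 : 0 < D y0 * (1 + x0 ^+ 2 + z0 ^+ 2).
  by rewrite mulr_gt0//; [exact: lt_le_trans dD|rewrite -addrA ltr_pwDl// addr_ge0 ?sqr_ge0].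
have B0 : 0 <= B by case/andP: al0; exact: le_trans.
suff : al y0 * (uxx y0 x0 + uxx y0 z0 - 2 * uxx y0 m) +
     ka y0 * (ux y0 x0 ^+ 2 + ux y0 z0 ^+ 2 - 2 * ux y0 m ^+ 2) +
     be y0 * (x0 * ux y0 x0 + z0 * ux y0 z0 - (x0 + z0) * ux y0 m) <=
     (12 * B ^+ 2 + 16 * B) * D y0 * (1 + x0 ^+ 2 + z0 ^+ 2).
  by move=> h'; rewrite /lam in h; lra.
apply: absorb.
- by rewrite D1 andbT; exact: lt_le_trans dD.
- apply: le_trans (uxB _ _ y0ab') _; rewrite ler_wpM2l// -addrA lerD2l.
  have : `|m| <= (`|x0| + `|z0|) / 2.
    by rewrite /m normrM (@ger0_norm _ (2^-1))// ler_wpM2r// ler_normD.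
  by have := normr_ge0 x0; have := normr_ge0 z0; lra.
- by apply: le_trans dx _; lra.
- by apply: le_trans dz _; lra.
Qed.

(** * Between midpoint gaps and second derivatives *)

Lemma derivable_is_derive1 (R : realType) (f : R -> R) (x : R) :
  derivable f x 1 -> is_derive x (1 : R) f (derive1 f x).
Proof. by move=> fx; apply: DeriveDef => //; rewrite derive1E. Qed.

(** The derivative [f'] is nonincreasing on each closed half-line, and the two meet at 0 by
    continuity of [f']; the mean value theorem on both halves of the segment concludes. *)
Lemma midpoint_gap_concave (R : realType) (f f' f'' : R -> R) :
  (forall h, is_derive h (1 : R) f (f' h)) -> continuous f' ->
  (forall h, h != 0 -> is_derive h (1 : R) f' (f'' h)) ->
  (forall h, h != 0 -> f'' h <= 0) ->
  forall x z, midpoint_gap f x z <= 0.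
Proof.
move=> df f'c df' f''0.
have dr h : h != 0 -> derivable f' h 1 by move=> /df' h0; exact: ex_derive.
have d0 h : h != 0 -> derive1 f' h <= 0.
  by move=> h0; have ? := df' _ h0; rewrite derive1E derive_val f''0.
have decrr x y : 0 <= x -> x <= y -> f' y <= f' x.
  apply: ler0_derive1_nincry => [h|h|].
  - by rewrite in_itv/= andbT => h0; apply: dr; rewrite gt_eqF.
  - by rewrite in_itv/= andbT => h0; apply: d0; rewrite gt_eqF.
  - exact: continuous_subspaceT.
have decrl x y : x <= y -> y <= 0 -> f' y <= f' x.
  apply: ler0_derive1_nincrNy => [h|h|].
  - by rewrite in_itv/= => h0; apply: dr; rewrite lt_eqF.
  - by rewrite in_itv/= => h0; apply: d0; rewrite lt_eqF.
  - exact: continuous_subspaceT.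
have decr x y : x <= y -> f' y <= f' x.
  move=> xy; have [x0|/ltW x0] := leP 0 x; first exact: decrr.
  have [y0|/ltW y0] := leP 0 y; last exact: decrl.
  exact: le_trans (decrr 0 y (lexx 0) y0) (decrl x 0 x0 (lexx 0)).
have fc (i : interval R) : {within [set` i], continuous f}.
  by apply: derivable_within_continuous => h _; exact: (@ex_derive _ _ _ _ _ _ _ (df h)).
move=> x z; wlog xz : x z / x <= z.
  move=> wlg; have [/wlg//|/ltW/wlg] := leP x z.
  by rewrite /midpoint_gap (addrC z) (addrC (f z)).
rewrite /midpoint_gap; set w := (x + z) / 2.
have xw : x <= w by rewrite /w; lra.
have wz : w <= z by rewrite /w; lra.
have [c1] := MVT_segment xw (fun h _ => df h) (fc _).
have [c2] := MVT_segment wz (fun h _ => df h) (fc _).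
rewrite !in_itv/= => /andP[wc _] h2 /andP[_ cw] h1.
have h3 := decr _ _ (le_trans cw wc).
have : (f' c2 - f' c1) * (z - x) <= 0 by rewrite mulr_le0_ge0//; lra.
have -> : f x + f z - 2 * f w = (f z - f w) - (f w - f x) by ring.
by rewrite h1 h2 /w; lra.
Qed.

(** The sign of [uxx] is turned into a gap inequality on the line [y = b], propagated in that form,
    which makes sense across [h = 0], and read off again from symmetric second differences. *)
Lemma concavity_propagates (R : realType) (a b B C : R) (gamma : R -> R)
    (u ux uxx : R -> R -> R) (al ka be c : R -> R) :
  a < b -> 0 <= C ->
  {within `[a, b], continuous gamma} ->
  (forall y, a <= y <= b -> 0 <= gamma y) ->
  (forall y, a < y < b -> derivable gamma y 1 /\ derive1 gamma y < 0) ->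
  (forall y, a < y < b -> [/\ 0 <= al y <= B, `|ka y| <= B & `|be y| <= B]) ->
  (forall y h, a <= y <= b -> is_derive h (1 : R) (u y) (ux y h)) ->
  {within [set p | a <= p.1 <= b], continuous (fun p : R * R => ux p.1 p.2)} ->
  (forall y h, a <= y <= b -> h != 0 -> is_derive h (1 : R) (ux y) (uxx y h)) ->
  (forall y h, a < y < b -> h != 0 -> is_derive y (1 : R) (u ^~ h)
     (derive1 gamma y * (al y * uxx y h + ka y * ux y h ^+ 2
                         + be y * h * ux y h + c y))) ->
  (forall y h, a <= y <= b -> `|ux y h| <= B * (1 + `|h|)) ->
  (forall y x z, a <= y <= b -> midpoint_gap (u y) x z <= C * (`|x| + `|z|)) ->
  (forall h, h != 0 -> uxx b h <= 0) ->
  forall y h, a <= y <= b -> h != 0 -> uxx y h <= 0.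
Proof.
move=> ab C0 gc g0 dg coefB du uxc dux pde uxB gapC uxx0 y h yab h0.
have bab : a <= b <= b by rewrite lexx ltW.
have dux' y' h' : a < y' < b -> h' != 0 -> is_derive h' (1 : R) (ux y') (uxx y' h').
  by case/andP => ? ?; apply: dux; rewrite !ltW.
have uxbc : continuous (ux b).
  apply: (continuous_comp_into (g := fun x : R => (b, x)) uxc) => // x.
  by apply: (@continuous_pair _ _ _ (cst b) id); [exact: cvg_cst|exact: cvg_id].
have gapb := midpoint_gap_concave (du b ^~ bab) uxbc (dux b ^~ bab) uxx0.
have gap0 := midpoint_gap_le0 ab C0 gc g0 dg coefB du uxc dux' pde uxB gapC gapb.
apply: (is_derive2_le0 _ (dux _ _ yab h0)) => [|s].
  by near=> x; exact: du.
have := gap0 y (h + s) (h - s) yab; rewrite /midpoint_gap.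
by have -> : (h + s + (h - s)) / 2 = h by field.
Unshelve. all: by end_near.
Qed.

(** * The squared negative part and its derivatives *)

Lemma is_derive_min0_sqr (R : realType) (h : R) :
  is_derive h (1 : R) (fun h : R => Num.min h 0 ^+ 2) (2 * Num.min h 0).
Proof.
have [h0|h0|->] := ltgtP h 0.
- apply: (@near_eq_is_derive _ _ _ (fun h : R => h ^+ 2)).
    by near=> x; rewrite (min_idPl _)// ltW//; near: x; exact: lt_nbhsl.
  by apply: is_derive_eq; rewrite /GRing.scale/=; ring.
- apply: (@near_eq_is_derive _ _ _ (fun h : R => 0)).
    by near=> x; rewrite (min_idPr _) ?expr0n// ltW//; near: x; exact: lt_nbhsr.
  by apply: is_derive_eq; ring.
(* At 0 the difference quotient of the square is [Num.min x 0] itself. *)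
- apply/is_derive1_caratheodory; exists (fun x => Num.min x 0); split.
  + by move=> z; have [z0|z0] := leP z 0; rewrite minxx; ring.
  + by apply: (@continuous_min _ _ id (cst 0)); [exact: cvg_id|exact: cvg_cst].
  + by rewrite minxx mulr0.
Unshelve. all: by end_near.
Qed.

Lemma is_derive_min0 (R : realType) (h : R) : h != 0 ->
  is_derive h (1 : R) (fun h : R => Num.min h 0) (heaviside (- h)).
Proof.
rewrite /heaviside oppr_gt0; have [h0|h0|//] := ltgtP h 0 => _.
- apply: (@near_eq_is_derive _ _ _ id).
    by near=> x; rewrite (min_idPl _)// ltW//; near: x; exact: lt_nbhsl.
- apply: (@near_eq_is_derive _ _ _ (fun h : R => 0)).
    by near=> x; rewrite (min_idPr _)// ltW//; near: x; exact: lt_nbhsr.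
Unshelve. all: by end_near.
Qed.

(** [Num.min h 0] is concave and nonpositive, so its square is convex. Subtracting this square from
    the field can therefore only lower the gap. *)
Lemma midpoint_gap_min0_sqr (R : realType) (x z : R) :
  0 <= midpoint_gap (fun h : R => Num.min h 0 ^+ 2) x z.
Proof.
rewrite /midpoint_gap.
have : (Num.min x 0 + Num.min z 0) / 2 <= Num.min ((x + z) / 2) 0 <= 0.
  rewrite ge_min lexx orbT andbT.
  have [?|?] := leP x 0; have [?|?] := leP z 0; have [?|?] := leP ((x + z) / 2) 0; lra.
move: (Num.min ((x + z) / 2) 0) (Num.min x 0) (Num.min z 0) => r p q /andP[pqr r0].
have : 0 <= (r - (p + q) / 2) * (- r - (p + q) / 2) by rewrite mulr_ge0//; lra.
have := sqr_ge0 (p - q); lra.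
Qed.

(** * The two concavity statements and the bounds on [F] *)

Theorem proposition12 (R : realType) (m : R) (gamma : R -> R)
    (j F : R -> R -> R)
    (hm : 0 < m < 1)
    (hgamma : fullRSB_profile gamma)
    (hj : fullRSB_field gamma m j)
    (hF : is_F gamma m j F)
    (hF0 : forall h : R, 0 <= in_tau m F 0 h <= 1)
    (hFeq : solves_F_equation gamma m j F)
    (hleft : smooth_coefficients gamma j (left_half m))
    (hright : smooth_coefficients gamma j (right_half m))
    (hbounded : exists C : R, forall y h : R,
       1 <= y <= m^-1 -> `|pd2 j y h| <= C) :
  forall tau h : R, 0 <= tau <= m^-1 - 1 -> 0 <= in_tau m F tau h <= 1.
Proof.
have [g0 gc dg _] := hgamma.
have [dj djc ddj jpde] := hj.
have [FE F0c] := hF.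
have [C jC] := hbounded.
set b := m^-1 in dj djc ddj jpde FE F0c jC *.
have b1 : 1 < b by case/andP: hm => m0 m1; rewrite /b invf_gt1.
have bb : 1 <= b <= b by rewrite lexx ltW.
have C0 : 0 <= C by apply: le_trans (jC b 0 bb).
have gcb : {within `[1, b], continuous gamma}.
  by apply: continuous_subspaceW gc => y; rewrite /= in_itv/= => /andP[].
have [yK yKb gmin] := EVT_min (ltW b1) gcb.
have gK0 : 0 < gamma yK by apply: g0; move: yKb; rewrite in_itv/= => /andP[].
pose K := (gamma yK)^-1.
have K0 : 0 < K by rewrite invr_gt0.
have gpos y : 1 <= y <= b -> 0 < gamma y by case/andP => + _; exact: g0.
have gK y : 1 <= y <= b -> 0 < (gamma y)^-1 <= K.
  by move=> yb; rewrite invr_gt0 gpos//= lef_pV2 ?posrE ?gpos// gmin ?in_itv.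
have g0' y : 1 <= y <= b -> 0 <= gamma y by move=> /gpos/ltW.
have dg' y : 1 < y < b -> derivable gamma y 1 /\ derive1 gamma y < 0.
  by case/andP => + _; exact: dg.
have ab y : 1 < y < b -> 1 <= y <= b by case/andP => ? ?; rewrite !ltW.
have dj1 y h : 1 <= y <= b -> is_derive h (1 : R) (j y) (pd2 j y h).
  by move=> yb; apply: derivable_is_derive1; exact: dj.
have dj2 y h : 1 <= y <= b -> h != 0 -> is_derive h (1 : R) (pd2 j y) (pd2 (pd2 j) y h).
  by move=> yb h0; apply: derivable_is_derive1; exact: ddj.
have jy y h : 1 < y < b -> h != 0 -> is_derive y (1 : R) (j ^~ h) (pd1 j y h).
  by move=> yb h0; apply: derivable_is_derive1; have [] := jpde y h yb h0.
have dgV y : 1 < y < b -> is_derive y (1 : R) (fun y => (gamma y)^-1) (- gamma y ^- 2 * derive1 gamma y).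
  move=> yb; have [gd _] := dg' _ yb; have hg := derivable_is_derive1 gd.
  by apply: is_deriveV; rewrite gt_eqF// gpos// ab.
have gc2 : {within [set p : R * R | 1 <= p.1 <= b], continuous (fun p : R * R => (gamma p.1)^-1)}.
  apply/subspace_continuousP => -[y h] /= yb.
  apply: cvgV; first by rewrite gt_eqF// gpos.
  have /subspace_continuousP/(_ y) gcy := gcb.
  apply: (@cvg_comp _ _ _ fst gamma _ _ _ _ (gcy _)); last by rewrite /= in_itv.
  move=> P [/= e e0 eP]; exists ([set z | ball y e z], setT).
    by split; [exact: nbhsx_ballx|exact: filterT].
  by move=> [z k] [/= ze _] zb; apply: eP => //=; rewrite in_itv.
have minc : continuous (fun h : R => Num.min h 0).
  by move=> h; apply: (@continuous_min _ _ id (cst 0)); [exact: cvg_id|exact: cvg_cst].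
(* The bound on [j'] makes [j] Lipschitz in [h], hence its gap grows at most linearly; [s] will be 1
   for the lower bound on [F] and -1 for the upper bound. *)
have jgap s y x z : `|s| <= 1 -> 1 <= y <= b ->
    s * (j y x + j y z - 2 * j y ((x + z) / 2)) <= C * (`|x| + `|z|).
  move=> s1 yb; set w := (x + z) / 2.
  have lip p q : `|j y q - j y p| <= C * `|q - p|.
    by apply: (is_derive_lipschitz (fun h => dj1 y h yb)) => h _; exact: jC.
  have lw : `|x - w| + `|z - w| <= `|x| + `|z|.
    have -> : x - w = (x - z) / 2 by rewrite /w; field.
    have -> : z - w = - ((x - z) / 2) by rewrite /w; field.
    rewrite normrN normrM (@ger0_norm _ (2^-1))//; have := ler_normB x z; lra.
  apply: le_trans (ler_norm _) _; rewrite normrM.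
  apply: (@le_trans _ _ (1 * `|j y x + j y z - 2 * j y w|)); first by rewrite ler_wpM2r.
  rewrite mul1r; have -> : j y x + j y z - 2 * j y w = (j y x - j y w) + (j y z - j y w) by ring.
  apply: le_trans (ler_normD _ _) _; apply: le_trans (lerD (lip _ _) (lip _ _)) _.
  by rewrite -mulrDr ler_wpM2l.
have minB (h : R) : `|Num.min h 0| <= `|h|.
  by have [//|] := leP h 0; rewrite normr0.
(* 1 bounds [(2 * y)^-1] and the coefficients of modulus 1/2, [C] bounds [j'], and [K] bounds
   [(gamma y)^-1]. *)
pose B := 1 + C + K.
have uB (s y h v : R) : `|s| <= 1 -> 1 <= y <= b -> `|v| <= `|h| ->
    `|s * pd2 j y h + v / gamma y| <= B * (1 + `|h|).
  move=> s1 yb vh; have /andP[gy gyK] := gK y yb.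
  apply: le_trans (ler_normD _ _) _; rewrite !normrM (@gtr0_norm _ (gamma y)^-1)//.
  have p1 : `|s| * `|pd2 j y h| <= C.
    by rewrite -(mul1r C); apply: ler_pM => //; exact: jC.
  have p2 : `|v| / gamma y <= `|h| * K by apply: ler_pM => //; exact: ltW.
  by have := normr_ge0 h; rewrite /B; nra.
have heavisideD (h : R) : h != 0 -> heaviside (- h) + heaviside h = 1.
  by rewrite /heaviside oppr_gt0; have [?|?|//] := ltgtP h 0; rewrite ?addr0 ?add0r.
have alB y : 1 < y < b -> 0 <= (2 * y)^-1 <= B.
  move=> /andP[y1 _]; have y2 : 1 <= 2 * y by lra.
  rewrite invr_ge0 (le_trans ler01 y2)/=; apply: (@le_trans _ _ 1).
    by rewrite invf_le1//; lra.
  by rewrite /B; lra.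
have minE (h : R) : h * heaviside (- h) = Num.min h 0.
  by rewrite /heaviside oppr_gt0; have [h0|h0|->] := ltgtP h 0; rewrite ?mulr1 ?mulr0.
have F1 h : h != 0 -> 0 <= F b h <= 1.
  by move=> _; have := hF0 h; rewrite /in_tau subr0.
have gJ2 y h : 1 <= y <= b -> h != 0 ->
    gamma y * (pd2 (pd2 j) y h - heaviside (- h) / gamma y) = - F y h.
  by move=> yb h0; rewrite FE//; field; rewrite gt_eqF// gpos.
have gK2 y h : 1 <= y <= b -> h != 0 ->
    gamma y * (- pd2 (pd2 j) y h - heaviside h / gamma y) = F y h - 1.
  by move=> yb h0; rewrite FE// -(heavisideD _ h0); field; rewrite gt_eqF// gpos.
(* Here [u''] is [- F / gamma]. *)
have concave1 : forall y h, 1 <= y <= b -> h != 0 -> pd2 (pd2 j) y h - heaviside (- h) / gamma y <= 0.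
  apply: (@concavity_propagates _ 1 b B C gamma
    (fun y h => j y h - Num.min h 0 ^+ 2 / 2 * (gamma y)^-1)
    (fun y h => pd2 j y h - Num.min h 0 * (gamma y)^-1) _
    (fun y => (2 * y)^-1) (cst (1 / 2)) (cst 0) (cst 0) b1 C0 gcb g0' dg').
  - move=> y yb; split; [exact: alB| |]; rewrite /= ger0_norm ?divr_ge0// /B; lra.
  - move=> y h yb; have h1 := dj1 y h yb; have h2 := is_derive_min0_sqr h.
    by apply: is_derive_eq; rewrite /GRing.scale/=; field; rewrite gt_eqF// gpos.
  - have c1 : {within [set p : R * R | 1 <= p.1 <= b], continuous (fun p : R * R => Num.min p.2 0)}.
      apply: continuous_subspaceT => p.
      by apply: (@continuous_comp _ _ _ snd (fun h : R => Num.min h 0)); [exact: cvg_snd|exact: minc].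
    by move=> p; apply: cvgB; [exact: djc|apply: cvgM; [exact: c1|exact: gc2]].
  - move=> y h yb h0; have h1 := dj2 y h yb h0; have h2 := is_derive_min0 h0.
    by apply: is_derive_eq; rewrite /GRing.scale/=; field; rewrite gt_eqF// gpos.
  - move=> y h yb h0; have h1 := jy y h yb h0; have h2 := dgV y yb.
    apply: is_derive_eq; rewrite /GRing.scale/=.
    have [_ ->] := jpde y h yb h0; rewrite minE.
    by field; rewrite !gt_eqF// ?gpos ?ab//; case/andP: yb => ? _; lra.
  - move=> y h yb; have := uB 1 y h (- Num.min h 0).
    by rewrite normr1 lexx normrN minB mul1r mulNr => /(_ isT yb isT).
  - move=> y x z yb; have := jgap 1 y x z; rewrite normr1 lexx mul1r => /(_ isT yb).
    apply: le_trans; have := midpoint_gap_min0_sqr x z.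
    have : 0 <= (gamma y)^-1 by rewrite invr_ge0 g0'.
    by rewrite /midpoint_gap; nra.
  - move=> h h0; rewrite -(pmulr_rle0 _ (gpos _ bb)) gJ2// oppr_le0.
    by case/andP: (F1 h h0).
(* The positive part max(h,0) is written [- Num.min (- h) 0], so that the previous derivatives carry
   over by reflection. *)
have dsqN (h : R) : is_derive h (1 : R) (fun h : R => Num.min (- h) 0 ^+ 2) (- (2 * Num.min (- h) 0)).
  rewrite -mulrN1; exact: (is_derive1_comp (is_derive_min0_sqr (- h)) (is_deriveNid h (1 : R))).
have dminN (h : R) : h != 0 -> is_derive h (1 : R) (fun h : R => Num.min (- h) 0) (- heaviside h).
  rewrite -mulrN1 -oppr_eq0 => h0; rewrite -[in heaviside h](opprK h).
  exact: (is_derive1_comp (is_derive_min0 h0) (is_deriveNid h (1 : R))).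
(* Here [u''] is [(F - 1) / gamma]. *)
have concave2 : forall y h, 1 <= y <= b -> h != 0 -> - pd2 (pd2 j) y h - heaviside h / gamma y <= 0.
  apply: (@concavity_propagates _ 1 b B C gamma
    (fun y h => - j y h - Num.min (- h) 0 ^+ 2 / 2 * (gamma y)^-1)
    (fun y h => - pd2 j y h + Num.min (- h) 0 * (gamma y)^-1) _
    (fun y => (2 * y)^-1) (cst (- 1 / 2)) (fun y => - (gamma y)^-1)
    (fun y => (2 * y * gamma y)^-1) b1 C0 gcb g0' dg').
  - move=> y yb; have /andP[gy0 gyK] := gK y (ab _ yb); split; first exact: alB.
      by rewrite /= mulNr normrN ger0_norm ?divr_ge0// /B; lra.
    by rewrite /= normrN gtr0_norm// /B; lra.
  - move=> y h yb; have h1 := dj1 y h yb; have h2 := dsqN h.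
    by apply: is_derive_eq; rewrite /GRing.scale/=; field; rewrite gt_eqF// gpos.
  - have c1 : {within [set p : R * R | 1 <= p.1 <= b], continuous (fun p : R * R => Num.min (- p.2) 0)}.
      apply: continuous_subspaceT => p.
      apply: (@continuous_comp _ _ _ (fun p : R * R => - p.2) (fun h : R => Num.min h 0)); last exact: minc.
      by apply: cvgN; exact: cvg_snd.
    move=> p; apply: cvgD; first by apply: cvgN; exact: djc.
    by apply: cvgM; [exact: c1|exact: gc2].
  - move=> y h yb h0; have h1 := dj2 y h yb h0.
    have h2 := dminN h h0.
    by apply: is_derive_eq; rewrite /GRing.scale/=; field; rewrite gt_eqF// gpos.
  - move=> y h yb h0; have h1 := jy y h yb h0; have h2 := dgV y yb.
    apply: is_derive_eq; rewrite /GRing.scale/=.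
    have [_ ->] := jpde y h yb h0; rewrite minE.
    (* The constant 1 yields the source [(2 * y * gamma y)^-1], and [heaviside h] goes into
       [u'']. *)
    have -> : heaviside (- h) = 1 - heaviside h by rewrite -(heavisideD h h0); ring.
    have y0 : y != 0 by rewrite gt_eqF//; case/andP: yb => ? _; lra.
    have gy0 : gamma y != 0 by rewrite gt_eqF// gpos// ab.
    (* The products of the positive and negative parts of [h] vanish only after splitting on the
       sign of [h]. *)
    have [[-> ->]|[-> ->]] : Num.min h 0 = h /\ Num.min (- h) 0 = 0 \/
        Num.min h 0 = 0 /\ Num.min (- h) 0 = - h.
    - have [hle|hlt] := leP h 0; [left|right]; split => //.
        by apply/min_idPr; rewrite oppr_ge0.
      by apply/min_idPl; rewrite oppr_le0 ltW.
    - by field; rewrite y0 gy0.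
    - by field; rewrite y0 gy0.
  - move=> y h yb; have := uB (- 1) y h (Num.min (- h) 0).
    by rewrite normrN1 lexx (le_trans (minB _)) ?normrN// mulN1r => /(_ isT yb isT).
  - move=> y x z yb; have := jgap (- 1) y x z; rewrite normrN1 lexx => /(_ isT yb).
    apply: le_trans; have := midpoint_gap_min0_sqr (- x) (- z).
    have : 0 <= (gamma y)^-1 by rewrite invr_ge0 g0'.
    rewrite /midpoint_gap; have -> : (- x + - z) / 2 = - ((x + z) / 2) by field.
    nra.
  - move=> h h0; rewrite -(pmulr_rle0 _ (gpos _ bb)) gK2// subr_le0.
    by case/andP: (F1 h h0).
have Fne y h : 1 <= y <= b -> h != 0 -> 0 <= F y h <= 1.
  move=> yb h0; have := concave1 _ _ yb h0; have := concave2 _ _ yb h0.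
  rewrite -(pmulr_rle0 _ (gpos _ yb)) gK2// subr_le0 => ->.
  by rewrite -(pmulr_rle0 _ (gpos _ yb)) gJ2// oppr_le0 => ->.
(* On the initial line the value at [h = 0] is not fixed by [is_F], so the initial bound is used
   directly. *)
move=> tau h /andP[tau0 taub]; have [->|t0] := eqVneq tau 0; first exact: hF0.
rewrite /in_tau -/b; set y := b - tau.
have yb : 1 <= y < b.
  have t1 : 0 < tau by rewrite lt_neqAle eq_sym t0.
  by rewrite /y; apply/andP; split; lra.
have yb' : 1 <= y <= b by case/andP: yb => -> /ltW ->.
have [->|h0] := eqVneq h 0; last exact: Fne.
(* Past the initial line, [F y 0] is the limit of values at [x > 0], and the closed bounds pass to
   the limit. *)
have Fl : F y x @[x --> 0^'+] --> F y 0 by apply: cvg_at_right_filter; exact: F0c.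
have Fnear : \forall x \near (0 : R)^'+, 0 <= F y x <= 1.
  near=> x; apply: Fne => //; rewrite gt_eqF//; near: x; exact: nbhs_right_gt.
apply/andP; split.
  by apply: (cvgr_to_ge Fl); apply: filterS Fnear => x /andP[].
by apply: (cvgr_to_le Fl); apply: filterS Fnear => x /andP[].
Unshelve. all: by end_near.
Qed.
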